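(* Let $\Phi_{KZ}(X_0,X_1)$ be the Drinfel'd associator. The relation $\Phi_{KZ}(X_0,X_1)\Phi_{KZ}(X_1,X_0)=1$ is equivalent to the family of relations $$\forall\, W\in\{X_0,X_1\}^*,\ W\ne\emptyset,\qquad \sum_{\substack{U_1,U_2\in\{X_0,X_1\}^*\\ U_1U_2=W}}(-1)^{\mathrm{dp}(U_1)}\zeta^{sh}(U_1)\,(-1)^{\mathrm{dp}(\theta(U_2))}\zeta^{sh}(\theta(U_2))=0,$$ and this family is equivalent to the family $$\forall\, W\in\{X_0,X_1\}^*,\ W\ne\emptyset,\qquad \sum_{\substack{U_1,U_2\in\{X_0,X_1\}^*\\ U_1U_2=W}}(-1)^{|U_2|}\zeta^{sh}(U_1)\,\zeta^{sh}(\theta(U_2))=0 .$$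
   Context: $\{X_0,X_1\}^*$ is the set of words in $X_0,X_1$ (with empty word $\emptyset=1$); $|W|$ is the length of $W$, $\mathrm{dp}(W)$ its number of letters $X_1$; $\theta$ exchanges $X_0$ and $X_1$. The shuffle-regularized multiple zeta values $(\zeta^{sh}(W))_W$ are the real numbers determined by: $\zeta^{sh}(X_0)=\zeta^{sh}(X_1)=0$; $\zeta^{sh}(X_0^{k_1-1}X_1\cdots X_0^{k_p-1}X_1)=\sum_{n_1>\cdots>n_p>0}n_1^{-k_1}\cdots n_p^{-k_p}$ if $k_1\ge2$; $\zeta^{sh}(V)\zeta^{sh}(W)=\sum_U\zeta^{sh}(U)$ over all shuffles $U$ of $V,W$ (with multiplicity); $\zeta^{sh}(\emptyset)=1$. The Drinfel'd associator in $\mathbb C\langle\langle X_0,X_1\rangle\rangle$ is $\Phi_{KZ}(X_0,X_1)=\sum_{W}(-1)^{\mathrm{dp}(W)}\zeta^{sh}(W)W$; $\Phi_{KZ}(X_1,X_0)$ is obtained by exchanging the variables. *)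

(* Defs.v *)
From HB Require Import structures.
From mathcomp Require Import all_boot all_order all_algebra.
From mathcomp Require Import all_classical all_reals all_analysis.
From mathcomp Require Import complex.
Set Implicit Arguments.
Unset Strict Implicit.
Unset Printing Implicit Defensive.
Import Order.TTheory GRing.Theory Num.Theory.
Local Open Scope ring_scope.
Local Open Scope complex_scope.

Definition letter := bool.
Definition X0 : letter := false.
Definition X1 : letter := true.
Definition word := seq letter.

Definition dp (W : word) : nat := count_mem X1 W.

Definition theta : word -> word := map negb.

Lemma thetaK : involutive theta.
Proof. by apply: mapK => -[]. Qed.

(* The pairs (U1, U2) with U1 U2 = W, each listed exactly once
   (see mem_splittings and splittings_uniq). *)
Definition splittings (W : word) : seq (word * word) :=
  [seq (take i W, drop i W) | i <- iota 0 (size W).+1].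

Lemma mem_splittings (W : word) (U : word * word) :
  (U \in splittings W) = (U.1 ++ U.2 == W).
Proof.
apply/mapP/eqP => [[i _ ->]|]; first exact: cat_take_drop.
case: U => U1 U2 <-; exists (size U1).
  by rewrite mem_iota add0n ltnS size_cat /= leq_addr.
by rewrite take_size_cat// drop_size_cat.
Qed.

Lemma splittings_uniq (W : word) : uniq (splittings W).
Proof.
rewrite map_inj_in_uniq ?iota_uniq// => i j.
rewrite !mem_iota !add0n !ltnS => iW jW [eij _].
by rewrite -(size_takel iW) -(size_takel jW) eij.
Qed.

Lemma splittings_nil : splittings [::] = [:: ([::], [::])].
Proof. by []. Qed.

Lemma splittings_cons (a : letter) (W : word) :
  splittings (a :: W) =
  ([::], a :: W) :: [seq (a :: U.1, U.2) | U <- splittings W].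
Proof.
rewrite /splittings -[iota 0 (size (a :: W)).+1]/(0%N :: iota (1 + 0) (size W).+1).
by rewrite iotaDl map_cons -!map_comp.
Qed.

(* The shuffles of V and W, listed with multiplicity. *)
Fixpoint shuffles (V : word) : word -> seq word :=
  fix shuffles_V (W : word) : seq word :=
    match V, W with
    | [::], _ => [:: W]
    | _, [::] => [:: V]
    | a :: V', b :: W' =>
        map (cons a) (shuffles V' W) ++ map (cons b) (shuffles_V W')
    end.

(* X0^(k_1 - 1) X1 ... X0^(k_p - 1) X1 *)
Definition mzv_word (k : seq nat) : word :=
  flatten [seq rcons (nseq m.-1 X0) X1 | m <- k].

(* The sum over n_1 > ... > n_p > 0, as an extended real. *)
Definition mzv (R : realType) (p : nat) (k : p.-tuple nat) : \bar R :=
  \esum_(n in [set n : p.-tuple nat | sorted gtn n && all (leq 1) n]%classic)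
    (\prod_(i < p) (tnth n i)%:R ^- tnth k i)%:E.

(* The conditions that determine the shuffle-regularized multiple zeta values;
   the equation in zeta_mzv also says that the series converges. *)
Record is_zeta_sh (R : realType) (zeta : word -> R) : Prop := IsZetaSh {
  zeta_X0 : zeta [:: X0] = 0;
  zeta_X1 : zeta [:: X1] = 0;
  zeta_mzv : forall (p : nat) (k : p.+1.-tuple nat),
    (forall i, 1 <= tnth k i)%N -> (2 <= thead k)%N ->
    (zeta (mzv_word k))%:E = mzv R k;
  zeta_shuffle : forall V W : word,
    zeta V * zeta W = \sum_(U <- shuffles V W) zeta U;
  zeta_nil : zeta [::] = 1
}.

(* The ring K<<X0, X1>>: a series is the function giving the coefficient of
   each word, and the product is the Cauchy product (not the pointwise one). *)
Definition ncseries (K : nzRingType) := word -> K.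

HB.instance Definition _ (K : nzRingType) :=
  GRing.Zmodule.copy (ncseries K) (word -> K).

Section NcSeries.
Variable K : nzRingType.
Implicit Types f g h : ncseries K.

Definition ncseries_one : ncseries K := fun W => (W == [::])%:R.

Definition ncseries_mul f g : ncseries K :=
  fun W => \sum_(U <- splittings W) f U.1 * g U.2.

Let mul_nil f g : ncseries_mul f g [::] = f [::] * g [::].
Proof. by rewrite /ncseries_mul splittings_nil big_seq1. Qed.

Let mul_cons f g a W : ncseries_mul f g (a :: W) =
  f [::] * g (a :: W) + ncseries_mul (fun V => f (a :: V)) g W.
Proof. by rewrite /ncseries_mul splittings_cons big_cons big_map. Qed.

Let mulDl : left_distributive ncseries_mul +%R.
Proof.
move=> f g h; apply/funext => W; rewrite /ncseries_mul -[RHS]big_split /=.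
by apply: eq_bigr => U _; rewrite -mulrDl.
Qed.

Let mulDr : right_distributive ncseries_mul +%R.
Proof.
move=> f g h; apply/funext => W; rewrite /ncseries_mul -[RHS]big_split /=.
by apply: eq_bigr => U _; rewrite -mulrDr.
Qed.

Let mulZl (c : K) f g W :
  ncseries_mul (fun V => c * f V) g W = c * ncseries_mul f g W.
Proof.
by rewrite /ncseries_mul big_distrr; apply: eq_bigr => U _; rewrite -mulrA.
Qed.

Let mulA : associative ncseries_mul.
Proof.
move=> f g h; apply/funext => W; elim: W f g => [|a W IH] f g.
  by rewrite !mul_nil mulrA.
rewrite !mul_cons mul_nil mulrDr -!addrA mulrA; congr (_ + _).
rewrite IH -mulZl.
have -> : (fun V => ncseries_mul f g (a :: V)) =
    ((fun V => f [::] * g (a :: V)) : ncseries K) +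
    ncseries_mul (fun V => f (a :: V)) g.
  by apply/funext => V; rewrite mul_cons.
by rewrite mulDl.
Qed.

Let mul0 g W : ncseries_mul (fun=> 0) g W = 0.
Proof. by rewrite /ncseries_mul big1// => U _; rewrite mul0r. Qed.

Let mul1 : left_id ncseries_one ncseries_mul.
Proof.
move=> f; apply/funext => -[|a W].
  by rewrite mul_nil /ncseries_one mul1r.
by rewrite mul_cons /ncseries_one /= mul1r mul0 addr0.
Qed.

Let mulr1' : right_id ncseries_one ncseries_mul.
Proof.
move=> f; apply/funext => W; elim: W f => [|a W IH] f.
  by rewrite mul_nil /ncseries_one mulr1.
by rewrite mul_cons IH /ncseries_one /= mulr0 add0r.
Qed.

Let one_neq0 : ncseries_one != 0.
Proof.
apply/eqP => /(congr1 (fun f : ncseries K => f [::])) /eqP.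
by rewrite /ncseries_one /= oner_eq0.
Qed.

HB.instance Definition _ := GRing.Zmodule_isNzRing.Build (ncseries K)
  mulA mul1 mulr1' mulDl mulDr one_neq0.

Lemma ncseries_mulE f g (W : word) :
  (f * g) W = \sum_(U <- splittings W) f U.1 * g U.2.
Proof. by []. Qed.

Lemma ncseries_oneE (W : word) : (1 : ncseries K) W = (W == [::])%:R.
Proof. by []. Qed.

(* f(X1, X0): the coefficient of theta W in f becomes that of W, and theta is
   an involution. *)
Definition ncseries_swap f : ncseries K := fun W => f (theta W).

End NcSeries.

Definition Phi_KZ (R : realType) (zeta : word -> R) : ncseries R[i] :=
  fun W => (-1) ^+ dp W * (zeta W)%:C.

(* Main.v *)
Require Import Defs.
From HB Require Import structures.
From mathcomp Require Import all_boot all_order all_algebra.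
From mathcomp Require Import all_classical all_reals all_analysis.
From mathcomp Require Import complex.
From mathcomp Require Import zify.
Set Implicit Arguments.
Unset Strict Implicit.
Unset Printing Implicit Defensive.
Import Order.TTheory GRing.Theory Num.Theory.
Local Open Scope ring_scope.

(** Two power series in noncommuting variables are equal exactly when their
    coefficients agree at every word. The coefficient of W in
    Phi(X0, X1) Phi(X1, X0) is the real number given by the first signed sum
    over the factorizations W = U1 U2, embedded in the complex numbers
    ([coef_Phi_KZ_mul_swap]); it is 1 at the empty word because the zeta value
    there is 1, so only the nonempty words impose a condition.

    The two families agree word by word up to a global sign. The map theta
    exchanges the two letters, so dp (theta U2) and dp U2 add up to the length
    of U2, and the parity of dp U1 + dp (theta U2) is that of dp W + |U2|. The
    factor (-1)^(dp W) is the same for every factorization of W and leaves the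
    vanishing of the sum unchanged ([sum_splittings_sign]). *)

Lemma dp_theta (W : word) : (dp (theta W) + dp W = size W)%N.
Proof. by elim: W => //= -[] W <-; rewrite /dp /=; lia. Qed.

Lemma dp_cat (U V : word) : dp (U ++ V) = (dp U + dp V)%N.
Proof. exact: count_cat. Qed.

Lemma sign_dp_theta (K : pzRingType) (U V : word) :
  (-1) ^+ (dp U + dp (theta V)) = (-1) ^+ (dp (U ++ V) + size V) :> K.
Proof.
rewrite -signr_odd -[RHS]signr_odd dp_cat -(dp_theta V).
by congr ((-1) ^+ nat_of_bool _); lia.
Qed.

(** The sign depends on the factorization only through |U2|, once the common
    factor (-1)^(dp W) has been taken out; this holds for arbitrary
    coefficients. *)
Lemma sum_splittings_sign (K : comPzRingType) (f g : word -> K) (W : word) :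
  \sum_(U <- splittings W)
    (-1) ^+ dp U.1 * f U.1 * ((-1) ^+ dp (theta U.2) * g (theta U.2)) =
  (-1) ^+ dp W *
    \sum_(U <- splittings W) (-1) ^+ size U.2 * f U.1 * g (theta U.2).
Proof.
rewrite big_distrr; apply: eq_big_seq => -[U V] /=.
rewrite mem_splittings => /eqP /= <-.
by rewrite mulrACA -exprD sign_dp_theta exprD !mulrA.
Qed.

Lemma coef_Phi_KZ_mul_swap (R : realType) (zeta : word -> R) (W : word) :
  (Phi_KZ zeta * ncseries_swap (Phi_KZ zeta)) W =
  (\sum_(U <- splittings W)
     (-1) ^+ dp U.1 * zeta U.1 *
     ((-1) ^+ dp (theta U.2) * zeta (theta U.2)))%:C%C.
Proof.
rewrite ncseries_mulE rmorph_sum; apply: eq_bigr => U _.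
by rewrite /ncseries_swap /Phi_KZ !rmorphM !rmorph_sign.
Qed.

Theorem corollary2p5 (R : realType) (zeta : word -> R)
    (zetaP : is_zeta_sh zeta) :
  (Phi_KZ zeta * ncseries_swap (Phi_KZ zeta) = 1 <->
   forall W : word, W <> [::] ->
     \sum_(U <- splittings W)
       (-1) ^+ dp U.1 * zeta U.1 *
       ((-1) ^+ dp (theta U.2) * zeta (theta U.2)) = 0)
  /\
  ((forall W : word, W <> [::] ->
     \sum_(U <- splittings W)
       (-1) ^+ dp U.1 * zeta U.1 *
       ((-1) ^+ dp (theta U.2) * zeta (theta U.2)) = 0) <->
   (forall W : word, W <> [::] ->
     \sum_(U <- splittings W)
       (-1) ^+ size U.2 * zeta U.1 * zeta (theta U.2) = 0)).
Proof.
split; split.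
- move=> Phi1 W /eqP/negPf W_neq0; apply: complexI.
  by rewrite -coef_Phi_KZ_mul_swap Phi1 ncseries_oneE W_neq0.
- move=> sum0; apply/funext => W; rewrite coef_Phi_KZ_mul_swap ncseries_oneE.
  case: W => [|a W]; last by rewrite sum0.
  by rewrite splittings_nil big_seq1 /= (zeta_nil zetaP) !mulr1.
- by move=> sum0 W /sum0 /eqP; rewrite sum_splittings_sign mulf_eq0 signr_eq0 => /eqP.
- by move=> sum0 W /sum0 sumW0; rewrite sum_splittings_sign sumW0 mulr0.
Qed.
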